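(* Let $2\le k\le n-1$ and let $G$ be a connected graph with $n$ vertices and chromatic number $k$ (or, alternatively, clique number $k$). Then $$\sigma_2(G)\ge\begin{cases}2n+2k^2-6k+2 & \text{if } 2\le k\le\lfloor\frac{n+1}{2}\rfloor,\\ (8k-3)n-2n^2-6k^2+4k-1 & \text{if } \lfloor\frac{n+1}2\rfloor<k<\lceil\frac{2n+1}{3}\rceil,\\ 2(k-1)n-\frac{3k^2}{2}+\frac{5k}{2}-1 & \text{if }\lceil\frac{2n+1}3\rceil\le k\le n-1.\end{cases}$$ Equality holds if and only if $G=K_s\vee(K_{k-s}+\overline{K}_{n-k})$, where $s=1$ in the first case, $s\in\{4k-2n-2,\,4k-2n-1\}$ in the second case, and $s=k-1$ in the third case.
   Context: All graphs are finite, simple, undirected. For a connected graph $G$ and $u\in V(G)$, $\varepsilon_G(u)=\max_v d_G(u,v)$, and $\sigma_2(G)=\sum_{uv\in E(G)}\varepsilon_G(u)\varepsilon_G(v)$. $K_r$ is the complete graph, $\overline{K}_r$ the edgeless graph on $r$ vertices; $G+H$ is the disjoint union, and $G\vee H$ (the join) is obtained from $G+H$ by adding all edges between $V(G)$ and $V(H)$. *)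

(* Defs.v *)
(* A simple graph is a symmetric irreflexive relation
   e : rel T on a finite type T (vertex set V(G) = T, n = #|T|). *)
From mathcomp Require Import all_boot all_order all_algebra.
Set Implicit Arguments. Unset Strict Implicit. Unset Printing Implicit Defensive.

Section Graphs.
Variable T : finType.
Variable e : rel T.

Definition connected_graph : Prop := forall u v : T, connect e u v.

Definition walk_of_len (k : nat) (u v : T) : bool :=
  [exists p : k.-tuple T, path e u p && (last u p == v)].

(* d_G(u,v): least length of a u-v walk (= length of a shortest path).
   For a connected graph this is < #|T|; the value #|T| is only a
   default for disconnected pairs, never used below. *)
Definition dist (u v : T) : nat :=
  find (fun k => walk_of_len k u v) (iota 0 #|T|).

Definition ecc (u : T) : nat := \max_(v : T) dist u v.

Definition edge_set : {set {set T}} :=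
  [set [set u; v] | u in T, v in T & e u v].

Definition sigma2 : nat := \sum_(E in edge_set) \prod_(x in E) ecc x.

Definition colorable (k : nat) : bool :=
  [exists f : {ffun T -> 'I_k}, [forall u, forall v, e u v ==> (f u != f v)]].

Definition is_chromatic_number (k : nat) : Prop :=
  colorable k /\ (forall j, j < k -> ~~ colorable j).

Definition is_clique (A : {set T}) : bool :=
  [forall x in A, forall y in A, (x != y) ==> e x y].

Definition is_clique_number (k : nat) : Prop :=
  (exists A : {set T}, is_clique A /\ #|A| = k) /\
  (forall A : {set T}, is_clique A -> #|A| <= k).

End Graphs.

Definition isomorphic (T1 T2 : finType) (e1 : rel T1) (e2 : rel T2) : Prop :=
  exists f : T1 -> T2, bijective f /\ forall x y, e2 (f x) (f y) = e1 x y.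

Definition K_rel (r : nat) : rel 'I_r := fun x y => x != y.
Definition Kbar_rel (r : nat) : rel 'I_r := fun _ _ => false.

Definition sum_rel (T1 T2 : finType) (e1 : rel T1) (e2 : rel T2) : rel (T1 + T2) :=
  fun x y => match x, y with
             | inl a, inl b => e1 a b
             | inr a, inr b => e2 a b
             | _, _ => false
             end.

Definition join_rel (T1 T2 : finType) (e1 : rel T1) (e2 : rel T2) : rel (T1 + T2) :=
  fun x y => match x, y with
             | inl a, inl b => e1 a b
             | inr a, inr b => e2 a b
             | _, _ => true
             end.

Definition extremal (n k s : nat) : rel ('I_s + ('I_(k - s) + 'I_(n - k)))%type :=
  join_rel (@K_rel s) (sum_rel (@K_rel (k - s)) (@Kbar_rel (n - k))).
Arguments extremal : clear implicits.

(* Main.v *)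
(** Let U be the set of the s universal vertices. If s > 0, vertices of U have
    eccentricity 1 and all others 2, so sigma_2 is a function of n, s and the
    number of edges of G - U; if s = 0, all eccentricities are at least 2. If
    fewer than k vertices had degree at least k - 1, a greedy coloring would use
    at most k - 1 colors, so G has k vertices of degree at least k - 1 (which is
    clear when k is the clique number). At least k - s of them lie outside U and
    have degree at least k - s - 1 in G - U. Counting degrees bounds the number of
    edges of G - U from below by that of K_(k-s), with equality only if
    G - U = K_(k-s) + isolated vertices. What remains is to minimize a
    convex quadratic polynomial in the integer s over 1 <= s <= k - 1, the case
    s = 0 being strictly worse than s = 1. *)
Require Import Defs.
From mathcomp Require Import all_boot all_order all_algebra.
From mathcomp Require Import zify ring lra.
Set Implicit Arguments. Unset Strict Implicit. Unset Printing Implicit Defensive.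
Import Order.TTheory GRing.Theory Num.Theory.

(** * Adjacency in the extremal graphs *)

Section ExtremalAdjacency.
Variables n k s : nat.
Implicit Types x y : 'I_s + ('I_(k - s) + 'I_(n - k)).

Definition in_universal_part x : bool := if x is inl _ then true else false.

Definition in_clique_part x : bool := if x is inr (inl _) then true else false.

(** This matches the formula in [split_structure], so the two descriptions can be compared block by
    block. *)
Lemma extremalE x y : extremal n k s x y =
  (x != y) && [|| in_universal_part x, in_universal_part y
                | in_clique_part x && in_clique_part y].
Proof.
by case: x y => [i|[i|i]] [j|[j|j]]; rewrite /= ?andbT ?andbF.
Qed.

End ExtremalAdjacency.

(** * Universal vertices and sums over ordered adjacent pairs *)

Section Graph.
Variables (T : finType) (e : rel T).
Hypotheses (e_sym : symmetric e) (e_irr : irreflexive e).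

Definition nbhd (u : T) : {set T} := [set v | e u v].

Definition universal : {set T} := [set u | [forall v, (v != u) ==> e u v]].

Lemma exists_neq (u : T) : (1 < #|T|)%N -> exists v, v != u.
Proof.
move=> T2; apply/existsP; apply: contraTT T2; rewrite negb_exists => /forallP h.
rewrite -leqNgt; apply/card_le1_eqP => x y _ _.
by rewrite (eqP (negbNE (h x))) (eqP (negbNE (h y))).
Qed.

Lemma in_nbhd u v : (v \in nbhd u) = e u v.
Proof. by rewrite inE. Qed.

Lemma universal_adj u v : u \in universal -> e u v = (v != u).
Proof.
rewrite inE => /forallP /(_ v) /implyP h.
by apply/idP/idP => //; apply: contraL => /eqP ->; rewrite e_irr.
Qed.

Lemma nbhd_card_split u : u \notin universal ->
  #|nbhd u| = (#|universal| + #|nbhd u :\: universal|)%N.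
Proof.
move=> uN; rewrite -(cardsID universal (nbhd u)); congr addn.
apply: eq_card => v; rewrite in_setI in_nbhd.
apply: andb_idl => vU; rewrite e_sym universal_adj //.
by apply: contraNneq uN => ->.
Qed.

(** The edge {a, b} is the image of exactly two ordered pairs, (a, b) and (b, a). Doubling avoids a
    division by 2 throughout. *)
Lemma sigma2_double (w : T -> nat) :
  ((\sum_(E in edge_set e) \prod_(x in E) w x).*2 =
   \sum_u \sum_(v | e u v) w u * w v)%N.
Proof.
rewrite pair_big_dep /= -mul2n big_distrr /=.
rewrite (partition_big (fun p : T * T => [set p.1; p.2]) (mem (edge_set e))) /=;
  last first.
  by move=> [u v] /= uv; apply/imset2P; apply: (Imset2spec (x1 := u) (x2 := v)); rewrite ?inE.
apply: eq_bigr => E /imset2P[a b _]; rewrite inE => /andP[_ ab] ->.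
have nab : a != b by apply: contraTneq ab => ->; rewrite e_irr.
rewrite (bigD1 (a, b)) /=; last by rewrite ab eqxx.
rewrite (bigD1 (b, a)) /=; last first.
  by rewrite e_sym ab setUC eqxx xpair_eqE (negPf nab) andbF.
rewrite [X in (_ + (_ + X))%N]big1 ?addn0 => [|[u v] /=].
  rewrite big_setU1 /= ?inE // big_set1; lia.
move=> /andP[/andP[/andP[uv /eqP E1]]].
have : u \in [set a; b] by rewrite -E1 !inE eqxx.
have : v \in [set a; b] by rewrite -E1 !inE eqxx orbT.
rewrite !inE !xpair_eqE => /orP[] /eqP hv /orP[] /eqP hu; move: uv;
  by rewrite hu hv ?eqxx ?e_irr.
Qed.

(** A lower bound for the eccentricity, attained once some vertex is universal. *)
Definition low_ecc (u : T) : nat := if u \in universal then 1 else 2.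

(** Ordered pairs inside [universal] weigh 1, mixed pairs weigh 2 and occur in both orders, pairs
    outside weigh 4. The last sum is twice the number of edges of G - U. *)
Lemma sum_low_ecc :
  (\sum_u \sum_(v | e u v) low_ecc u * low_ecc v =
   #|universal| * #|universal|.-1 + 4 * (#|universal| * (#|T| - #|universal|))
   + 4 * \sum_(u in ~: universal) #|nbhd u :\: universal|)%N.
Proof.
set s := #|universal|.
have cC : #|~: universal| = (#|T| - s)%N by rewrite cardsCs setCK.
rewrite (bigID (mem universal)) /=.
have -> : (\sum_(u in universal) \sum_(v | e u v) low_ecc u * low_ecc v =
           \sum_(u in universal) (s.-1 + 2 * (#|T| - s)))%N.
  apply: eq_bigr => u uU; rewrite (bigID (mem universal)) /=; congr addn.
    rewrite (eq_bigr (fun _ => 1%N)) => [|v /andP[_ vU]]; last first.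
      by rewrite /low_ecc uU vU.
    rewrite sum1_card /s (cardsD1 u universal) uU /=.
    by apply: eq_card => v; rewrite !inE -topredE /= universal_adj // inE.
  rewrite (eq_bigr (fun _ => 2%N)) => [|v /andP[_ vU]]; last first.
    by rewrite /low_ecc uU (negPf vU).
  rewrite sum_nat_const -cC mulnC; congr muln; apply: eq_card => v.
  rewrite in_setC -topredE /= universal_adj //.
  by apply: andb_idl; apply: contraNneq => ->.
rewrite sum_nat_const -/s.
have -> : (\sum_(u | u \notin universal) \sum_(v | e u v) low_ecc u * low_ecc v =
           \sum_(u in ~: universal) (2 * s + 4 * #|nbhd u :\: universal|))%N.
  apply: eq_big => [u|u uN]; first by rewrite in_setC.
  rewrite (bigID (mem universal)) /=; congr addn.
    rewrite (eq_bigr (fun _ => 2%N)) => [|v /andP[_ vU]]; last first.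
      by rewrite /low_ecc (negPf uN) vU.
    rewrite sum_nat_const mulnC /s; congr muln; apply: eq_card => v.
    rewrite -topredE /=; apply: andb_idl => vU; rewrite e_sym universal_adj //.
    by apply: contraNneq uN => ->.
  rewrite (eq_bigr (fun _ => 4%N)) => [|v /andP[_ vU]]; last first.
    by rewrite /low_ecc (negPf uN) (negPf vU).
  rewrite sum_nat_const mulnC; congr muln; apply: eq_card => v.
  by rewrite in_setD in_nbhd -topredE andbC.
rewrite big_split /= sum_nat_const cC -big_distrr /=; nia.
Qed.

(** * Distances and eccentricities *)

Lemma walk0 u v : walk_of_len e 0 u v = (u == v).
Proof.
apply/existsP/eqP => [[p]|->]; first by rewrite tuple0 /= => /eqP.
by exists [tuple]; rewrite /= eqxx.
Qed.

Lemma walk1 u v : walk_of_len e 1 u v = e u v.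
Proof.
apply/existsP/idP => [[[[|x [|y p]] //= sp]]|uv].
  by rewrite andbT => /andP[ux /eqP <-].
by exists [tuple v]; rewrite /= uv eqxx.
Qed.

Lemma dist_le m u v : (m < #|T|)%N -> walk_of_len e m u v -> (dist e u v <= m)%N.
Proof.
move=> mT w; rewrite leqNgt; apply/negP => /(before_find 0%N).
by rewrite nth_iota // add0n w.
Qed.

Lemma dist_walk u v : (dist e u v < #|T|)%N -> walk_of_len e (dist e u v) u v.
Proof.
move=> h; have hh := h; rewrite /dist -[X in (_ < X)%N](size_iota 0) in h.
rewrite -has_find in h; have := nth_find 0%N h.
by rewrite nth_iota.
Qed.

Lemma dist_ge2 u v : (1 < #|T|)%N -> u != v -> ~~ e u v -> (2 <= dist e u v)%N.
Proof.
move=> T2 uv nuv; rewrite leqNgt; apply/negP => lt2.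
(* A value below 2 is below [#|T|], so it is not the default and some walk has this length. *)
have := dist_walk (leq_trans lt2 T2).
by case: (dist e u v) lt2 => [|[|]] // _; rewrite ?walk0 ?walk1 ?(negPf uv) ?(negPf nuv).
Qed.

Lemma low_ecc_le u : (1 < #|T|)%N -> (low_ecc u <= ecc e u)%N.
Proof.
move=> T2; rewrite /low_ecc; case: ifPn => [uU|].
  have [v vu] := exists_neq u T2.
  apply: leq_trans (leq_bigmax v); rewrite lt0n.
  apply: contraNneq vu => d0; have := @dist_walk u v.
  by rewrite d0 walk0 eq_sym; apply; apply: ltn_trans T2.
rewrite inE negb_forall => /existsP[v]; rewrite negb_imply => /andP[vu nuv].
apply: leq_trans (leq_bigmax v); apply: dist_ge2 => //; by rewrite eq_sym.
Qed.

Lemma ecc_low_ecc u : (2 < #|T|)%N -> (0 < #|universal|)%N -> ecc e u = low_ecc u.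
Proof.
move=> T3 /card_gt0P[c cU]; apply/eqP; rewrite eqn_leq low_ecc_le ?andbT //; last first.
  exact: ltn_trans T3.
apply/bigmax_leqP => v _; have [->|uv] := eqVneq u v.
  by apply: (@leq_trans 0); [apply: dist_le; rewrite ?walk0 //; lia|].
rewrite /low_ecc; case: ifPn => uU.
  by apply: dist_le; rewrite ?walk1 ?universal_adj 1?eq_sym //; lia.
have [euv|nuv] := boolP (e u v).
  by apply: (@leq_trans 1) => //; apply: dist_le; rewrite ?walk1 //; lia.
(* The universal vertex [c] is the midpoint of a walk of length 2; [dist] searches only lengths
   below [#|T|], whence at least three vertices. *)
apply: dist_le => //; apply/existsP; exists [tuple c; v].
have uc : u != c by apply: contraNneq uU => ->.
rewrite /= eqxx !andbT e_sym !universal_adj // uc /= eq_sym.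
by apply: contraNneq nuv => <-; rewrite e_sym universal_adj.
Qed.

Lemma sigma2_ge : (1 < #|T|)%N ->
  (\sum_u \sum_(v | e u v) low_ecc u * low_ecc v <= (sigma2 e).*2)%N.
Proof.
move=> T2; rewrite sigma2_double.
by do 2![apply: leq_sum => ? _]; apply: leq_mul; apply: low_ecc_le.
Qed.

Lemma sigma2_eq : (2 < #|T|)%N -> (0 < #|universal|)%N ->
  ((sigma2 e).*2 = \sum_u \sum_(v | e u v) low_ecc u * low_ecc v)%N.
Proof.
move=> T3 U0; rewrite sigma2_double.
by do 2![apply: eq_bigr => ? _]; rewrite !ecc_low_ecc.
Qed.

(** * Vertices of high degree *)

(* Give the at most [m] vertices of degree [>= m] distinct colors, then extend
   greedily to the others. *)
Lemma colorable_few_high m :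
  (#|[set u | (m <= #|nbhd u|)%N]| <= m)%N -> (0 < m)%N -> colorable e m.
Proof.
case: m => // m; set A := [set u | _] => cA _.
(* Induction on the list of vertices already colored: [f] is total but has to be proper only on [A]
   and [s]. *)
suff ext (s : seq T) : exists f : {ffun T -> 'I_m.+1}, forall u v,
    u \in A \/ u \in s -> v \in A \/ v \in s -> e u v -> f u != f v.
  have [f Pf] := ext (enum T); apply/existsP; exists f.
  by apply/forallP => u; apply/forallP => v; apply/implyP; apply: Pf; right;
     rewrite mem_enum.
elim: s => [|x s [f IH]].
  exists [ffun u => inord (index u (enum A))] => u v [uA|] // [vA|] // uv.
  have ltA w : w \in A -> (index w (enum A) < m.+1)%N.
    by move=> wA; apply: leq_trans cA; rewrite cardE index_mem mem_enum.
  rewrite !ffunE; apply: contraTneq uv => /(congr1 val).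
  rewrite /= !inordK ?ltA // => /(congr1 (nth u (enum A))).
  rewrite !nth_index ?mem_enum // => <-.
  by rewrite e_irr.
have [xA|xA] := boolP (x \in A).
  have xs w : w \in A \/ w \in x :: s -> w \in A \/ w \in s.
    by rewrite in_cons => -[?|/orP[/eqP ->|?]]; [left|left|right].
  by exists f => u v /xs hu /xs hv; apply: IH.
(* If all m+1 colors occurred around [x], its degree would be at least m+1, putting it in [A]. *)
have [c cN] : exists c, c \notin f @: nbhd x.
  apply/existsP; rewrite -negb_forall; apply: contra xA => /forallP h.
  rewrite inE; apply: leq_trans (leq_imset_card f _).
  rewrite -[X in (X <= _)%N](card_ord m.+1); apply: subset_leq_card.
  by apply/subsetP => c _.
exists [ffun u => if u == x then c else f u] => u v hu hv uv; rewrite !ffunE.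
have red w : w != x -> w \in A \/ w \in x :: s -> w \in A \/ w \in s.
  by move=> /negPf nw; rewrite in_cons nw.
have [ux|ux] := eqVneq u x; have [vx|vx] := eqVneq v x.
- by move: uv; rewrite ux vx e_irr.
- apply: contraNneq cN => ->; apply: imset_f; by rewrite inE -ux.
- apply: contraNneq cN => <-; apply: imset_f; by rewrite inE -vx e_sym.
- by apply: IH => //; apply: red.
Qed.

Lemma chromatic_high k : (1 < k)%N -> is_chromatic_number e k ->
  (k <= #|[set u | (k.-1 <= #|nbhd u|)%N]|)%N.
Proof.
move=> k2 [_ /(_ k.-1) h]; rewrite leqNgt; apply/negP => hA.
have kk : (k.-1 < k)%N by lia.
by move: (h kk); rewrite colorable_few_high //; lia.
Qed.

Lemma clique_high k : is_clique_number e k ->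
  (k <= #|[set u | (k.-1 <= #|nbhd u|)%N]|)%N.
Proof.
move=> [[A [/forall_inP cl <-]] _]; apply: subset_leq_card; apply/subsetP => u uA.
rewrite inE (cardsD1 u A) uA /=; apply: subset_leq_card; apply/subsetP => v.
rewrite !inE => /andP[vu vA]; have /forall_inP/(_ v vA)/implyP := cl u uA.
by apply; rewrite eq_sym.
Qed.

(** * Cliques and the number of universal vertices *)

Lemma colorable_clique k (A : {set T}) : colorable e k -> is_clique e A -> (#|A| <= k)%N.
Proof.
move=> /existsP[f /forallP Pf] /forall_inP cl.
rewrite -[k]card_ord -(@card_in_imset _ _ f) ?max_card //.
move=> u v uA vA fuv; apply/eqP; apply: contraTT (eqxx (f u)) => uv.
have /forall_inP/(_ v vA)/implyP/(_ uv) uv1 := cl u uA.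
by have /forallP/(_ v)/implyP/(_ uv1) := Pf u; rewrite fuv.
Qed.

(** The universal vertices form a clique, and adding any further vertex keeps it a clique. With k of
    them there would be a clique on more than k vertices, the case of a complete graph being covered
    by k < n. *)
Lemma universal_lt k : (k < #|T|)%N ->
  is_chromatic_number e k \/ is_clique_number e k -> (#|universal| < k)%N.
Proof.
move=> kT h.
have bound A : is_clique e A -> (#|A| <= k)%N.
  by case: h => [[ck _]|[_]]; [apply: colorable_clique|apply].
have clU (B : {set T}) : B \subset universal -> is_clique e B.
  move=> /subsetP sB; apply/forall_inP => u uB; apply/forall_inP => v vB.
  by apply/implyP => uv; rewrite universal_adj ?sB // eq_sym.
rewrite ltnNge; apply/negP => kU.
have [UT|] := eqVneq universal setT.
  by have := bound _ (clU _ (subxx _)); rewrite UT cardsT; lia.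
rewrite -subTset => /subsetPn[x _ xU].
suff : is_clique e (x |: universal) by move/bound; rewrite cardsU1 xU; lia.
apply/forall_inP => u; rewrite !in_setU1 => uu; apply/forall_inP => v.
rewrite !in_setU1 => vv; apply/implyP => uv.
case/orP: uu => [/eqP ux|uU]; last by rewrite universal_adj // eq_sym.
case/orP: vv => [/eqP vx|vU]; last by rewrite e_sym universal_adj.
by rewrite ux vx eqxx in uv.
Qed.

Lemma nbhd_gt0 u : connected_graph e -> (1 < #|T|)%N -> (0 < #|nbhd u|)%N.
Proof.
move=> ec T2; have [v vu] := exists_neq u T2.
have /connectP[[|w p] /= pth lst] := ec u v; first by rewrite lst eqxx in vu.
by apply/card_gt0P; exists w; rewrite inE; case/andP: pth.
Qed.

(** * The extremal graphs described inside [T], and their sigma_2 *)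

Definition split_structure (k s : nat) : Prop :=
  exists U B : {set T}, [/\ [disjoint U & B], #|U| = s, #|B| = (k - s)%N &
    forall x y, e x y =
      (x != y) && [|| x \in U, y \in U | (x \in B) && (y \in B)]].

(** The value of [sum_low_ecc] for s universal vertices when G - U has the degree sum of a complete
    graph on k - s vertices. *)
Definition twice_sigma2_extremal (n k s : nat) : nat :=
  (s * s.-1 + 4 * (s * (n - s)) + 4 * ((k - s) * (k - s).-1))%N.

Lemma split_sigma2 k s : (0 < s < k)%N -> (k < #|T|)%N -> split_structure k s ->
  (sigma2 e).*2 = twice_sigma2_extremal #|T| k s.
Proof.
move=> s0 kT [U [B [dUB cU cB eE]]].
(* As [U] and [B] have k < n vertices together, some [c] lies in neither. It is not adjacent to [B],
   so no vertex of [B] is universal. *)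
have [c cN] : exists c, c \notin U :|: B.
  apply/existsP; rewrite -negb_forall; apply/negP => /forallP h.
  have : (#|T| <= #|U :|: B|)%N.
    by rewrite -cardsT; apply: subset_leq_card; apply/subsetP => x _.
  by rewrite cardsU (disjoint_setI0 dUB) cards0 cU cB; lia.
move: cN; rewrite inE negb_or => /andP[cU' cB'].
have uE : universal = U.
  apply/setP => u; apply/idP/idP => [uU|uU]; last first.
    by rewrite inE; apply/forallP => v; apply/implyP => vu; rewrite eE eq_sym vu uU.
  apply: contraTT uU => uU; rewrite inE negb_forall; apply/existsP.
  have [uB|uB] := boolP (u \in B).
    exists c; rewrite eE (negPf uU) (negPf cU') (negPf cB') /= !andbF.
    by rewrite implybF negbK; apply: contraNneq cB' => ->.
  (* Since s < k, [B] is nonempty; its vertices are non-neighbors of [u]. *)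
  have /card_gt0P[b bB] : (0 < #|B|)%N by rewrite cB; lia.
  exists b; have bu : b != u by apply: contraNneq uB => <-.
  by rewrite bu eE (negPf uU) (negPf uB) (disjointFl dUB bB) andbF.
rewrite sigma2_eq ?uE ?cU; [|lia|lia].
rewrite sum_low_ecc uE cU /twice_sigma2_extremal; congr addn; congr muln.
rewrite (big_setID B) /= [X in (_ + X)%N]big1 ?addn0 => [|u]; last first.
  rewrite !inE => /andP[uB uU]; apply/eqP; rewrite cards_eq0 -subset0.
  apply/subsetP => v; rewrite !inE eE (negPf uB) (negPf uU) /= => /andP[vU].
  by rewrite (negPf vU) andbF.
have -> : ~: U :&: B = B by apply/setIidPr; rewrite -disjoints_subset disjoint_sym.
rewrite -cB -sum_nat_const; apply: eq_bigr => u uB.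
rewrite (cardsD1 u B) uB /=; apply: eq_card => v.
rewrite !inE eE uB (disjointFl dUB uB) /= eq_sym.
have [vU|vU] /= := boolP (v \in U); last by [].
by rewrite (disjointFr dUB vU) andbF.
Qed.

(** * Lower bound by the degrees in G - U, and the case of equality *)

Lemma high_choose k : (k <= #|[set u | (k.-1 <= #|nbhd u|)%N]|)%N ->
  (#|universal| <= k <= #|T|)%N ->
  exists B : {set T}, [/\ B \subset ~: universal, #|B| = (k - #|universal|)%N &
    {in B, forall u, ((k - #|universal|).-1 <= #|nbhd u :\: universal|)%N}].
Proof.
move=> hi hk; set A := [set u | _] in hi.
(* At most [#|universal|] of the k high vertices are universal. Each other one loses exactly
   [#|universal|] neighbors in G - U. *)
have hA : (k - #|universal| <= #|A :\: universal|)%N.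
  rewrite cardsD; have := subset_leq_card (subsetIr A universal); lia.
exists [set x in take (k - #|universal|) (enum (A :\: universal))].
have mem u : u \in take (k - #|universal|) (enum (A :\: universal)) -> u \in A :\: universal.
  by move/mem_take; rewrite mem_enum.
split.
- by apply/subsetP => u; rewrite in_set => /mem; rewrite in_setD in_setC => /andP[].
- rewrite cardsE (card_uniqP _) ?take_uniq ?enum_uniq // size_take_min -cardE.
  by apply/minn_idPl.
- move=> u; rewrite in_set => /mem; rewrite in_setD => /andP[uU].
  by rewrite inE nbhd_card_split //; lia.
Qed.

(** The degrees of [B] alone exhaust the sum, so vertices outside [B] are isolated in G - U. All
    edges of G - U then lie inside [B], and the minimum degree makes [B] complete. *)
Lemma equality_split k (B : {set T}) : (#|universal| < k)%N ->
  B \subset ~: universal -> #|B| = (k - #|universal|)%N ->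
  {in B, forall u, ((k - #|universal|).-1 <= #|nbhd u :\: universal|)%N} ->
  (\sum_(u in ~: universal) #|nbhd u :\: universal| <=
     (k - #|universal|) * (k - #|universal|).-1)%N ->
  split_structure k #|universal|.
Proof.
move=> uk sB cB hB.
rewrite (big_setID B) /= (setIidPr sB) => hsum.
have hB0 : ((k - #|universal|) * (k - #|universal|).-1 <=
            \sum_(u in B) #|nbhd u :\: universal|)%N.
  by rewrite -{1}cB -sum_nat_const; apply: leq_sum.
have out u : u \notin universal -> u \notin B -> nbhd u :\: universal = set0.
  move=> uU uB; apply/eqP; rewrite -cards_eq0.
  suff : (\sum_(u in ~: universal :\: B) #|nbhd u :\: universal|)%N == 0%N.
    by rewrite sum_nat_eq0 => /forall_inP; apply; rewrite in_setD in_setC uU uB.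
  by apply/eqP; lia.
have nin u v : u \notin universal -> v \notin universal -> e u v -> v \in B.
  move=> uU vU uv; apply: contraT => vB.
  have := out v vU vB; move/setP/(_ u); by rewrite in_setD uU !inE e_sym uv.
have full u : u \in B -> nbhd u :\: universal = B :\ u.
  move=> uB; have uU : u \notin universal by have := subsetP sB u uB; rewrite in_setC.
  apply/eqP; rewrite eqEcard; apply/andP; split.
    apply/subsetP => v; rewrite in_setD => /andP[vU]; rewrite inE => uv.
    rewrite in_setD1 (nin u) // andbT; apply: contraTneq uv => ->; by rewrite e_irr.
  by have := hB u uB; have := cardsD1 u B; rewrite uB cB; lia.
exists universal, B; split => //; first by rewrite disjoint_sym disjoints_subset.
move=> x y; have [xU|xU] /= := boolP (x \in universal).
  by rewrite universal_adj // andbT eq_sym.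
have [yU|yU] /= := boolP (y \in universal).
  by rewrite e_sym universal_adj // andbT.
have [xB|xB] := boolP (x \in B); last first.
  rewrite andbF; have := out x xU xB; move/setP/(_ y).
  by rewrite in_setD yU !inE.
have := full x xB; move/setP/(_ y); rewrite in_setD yU in_setD1 inE /= => ->.
by rewrite eq_sym.
Qed.

(** The witness s is the number of universal vertices if positive. Otherwise it is 1, and the
    inequality is strict, so the equality clause is vacuous. *)
Lemma sigma2_dichotomy k : connected_graph e -> (1 < k)%N -> (k < #|T|)%N ->
  is_chromatic_number e k \/ is_clique_number e k ->
  exists2 s, (0 < s < k)%N &
    (twice_sigma2_extremal #|T| k s <= (sigma2 e).*2)%N /\
    ((sigma2 e).*2 = twice_sigma2_extremal #|T| k s -> split_structure k s).
Proof.
move=> ec k2 kT h; have uk := universal_lt kT h.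
have hi : (k <= #|[set u | (k.-1 <= #|nbhd u|)%N]|)%N.
  by case: h => h; [apply: chromatic_high|apply: clique_high].
have [|B [sB cB hB]] := high_choose hi; first by lia.
have hB0 : ((k - #|universal|) * (k - #|universal|).-1 <=
            \sum_(u in B) #|nbhd u :\: universal|)%N.
  by rewrite -{1}cB -sum_nat_const; apply: leq_sum.
have [U0|U0] := posnP #|universal|; last first.
  exists #|universal|; first by rewrite U0.
  rewrite sigma2_eq ?sum_low_ecc /twice_sigma2_extremal; [split|lia|lia].
    rewrite leq_add2l leq_mul2l (big_setID B) /= (setIidPr sB); lia.
  move=> E; apply: (equality_split uk sB cB hB); lia.
exists 1%N => //.
suff : (twice_sigma2_extremal #|T| k 1 < (sigma2 e).*2)%N by split; lia.
have T2 : (1 < #|T|)%N by lia.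
apply: leq_trans (sigma2_ge T2); rewrite sum_low_ecc.
(* By connectedness each of the n - k vertices outside [B] has degree at least 1. *)
have hC : (#|T| - k <= \sum_(u in ~: universal :\: B) #|nbhd u :\: universal|)%N.
  have UE := cards0_eq U0.
  apply: (@leq_trans #|~: universal :\: B|).
    by rewrite cardsD (setIidPr sB) cB UE setC0 cardsT cards0; lia.
  rewrite -sum1_card; apply: leq_sum => u _.
  by rewrite UE setD0; apply: nbhd_gt0.
rewrite (big_setID B) /= (setIidPr sB) /twice_sigma2_extremal.
move: hB0 hC; rewrite U0 subn0 -!subn1.
(* Once the product is abstracted as [p], the goal is linear; the two sides differ by at least 4(k -
   1) > 0. *)
have -> : (k * (k - 1) = (k - 1) * (k - 1 - 1) + 2 * (k - 1))%N by nia.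
rewrite !(mul0n, mul1n, muln0); move: ((k - 1) * _)%N => p.
move: (\sum_(u in B) #|nbhd u :\: universal|)%N => a.
move: (\sum_(u in _ :\: B) #|nbhd u :\: universal|)%N => b.
by move: kT; move: #|T| => n; clear -k2; lia.
Qed.

(** * Isomorphism with the extremal graphs *)

Lemma isomorphic_extremalP k s : (s <= k < #|T|)%N ->
  isomorphic e (extremal #|T| k s) <-> split_structure k s.
Proof.
move=> sk; split=> [[f [bf fE]]|[U [B [dUB cU cB eE]]]].
  have [g fK gK] := bf.
  exists [set x | in_universal_part (f x)], [set x | in_clique_part (f x)]; split.
  - by apply/pred0P => x /=; rewrite !inE; case: (f x) => [|[]].
  - rewrite -[RHS]card_ord -[RHS](@card_imset _ _ (g \o inl)); last first.
      by apply: inj_comp; [exact: can_inj gK|move=> ? ? []].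
    apply: eq_card => x; rewrite inE; apply/idP/imsetP => [|[i _ ->]]; last by rewrite /= gK.
    by case E: (f x) => [i|] // _; exists i; rewrite //= -E fK.
  - rewrite -[RHS]card_ord -[RHS](@card_imset _ _ (g \o inr \o inl)); last first.
      by apply: inj_comp; [apply: inj_comp; [exact: can_inj gK|]|]; move=> ? ? [].
    apply: eq_card => x; rewrite inE; apply/idP/imsetP => [|[i _ ->]]; last by rewrite /= gK.
    by case E: (f x) => [|[i|]] // _; exists i; rewrite //= -E fK.
  - by move=> x y; rewrite -fE extremalE (inj_eq (bij_inj bf)) !inE.
pose C := ~: (U :|: B).
have cC : #|C| = (#|T| - k)%N.
  rewrite /C cardsCs setCK cardsU (disjoint_setI0 dUB) cards0 cU cB; lia.
have /card_gt0P[x0 _] : (0 < #|T|)%N by lia.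
(* [g] enumerates [U], [B] and the rest [C] in turn. As it respects the blocks, injectivity is
   checked within each one, and equal cardinalities make it bijective. *)
pose g (x : 'I_s + ('I_(k - s) + 'I_(#|T| - k))) := match x with
  | inl i => nth x0 (enum U) i
  | inr (inl i) => nth x0 (enum B) i
  | inr (inr i) => nth x0 (enum C) i end.
have memg (D : {set T}) m (i : 'I_m) : #|D| = m -> nth x0 (enum D) i \in D.
  by move=> cD; rewrite -mem_enum mem_nth // -cardE cD.
have gU x : (g x \in U) = in_universal_part x.
  case: x => [i|[i|i]] /=; first exact: memg.
    by rewrite (disjointFl dUB) // memg.
  by apply/negbTE; have := memg C _ i cC; rewrite !inE negb_or => /andP[].
have gB x : (g x \in B) = in_clique_part x.
  case: x => [i|[i|i]] /=; last 2 first.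
  - exact: memg.
  - by apply/negbTE; have := memg C _ i cC; rewrite !inE negb_or => /andP[].
  by rewrite (disjointFr dUB) // memg.
have injn (D : {set T}) m (i j : 'I_m) : #|D| = m ->
    nth x0 (enum D) i = nth x0 (enum D) j -> i = j.
  move=> cD /eqP; rewrite nth_uniq ?enum_uniq -?cardE ?cD //.
  by move/eqP/val_inj.
have ginj : injective g.
  move=> x y E; have := gU x; have := gB x; rewrite E gU gB.
  by case: x y E => [i|[i|i]] [j|[j|j]] //= E _ _; do ?congr (inl _); do ?congr (inr _);
    do ?congr (inl _); apply: injn E.
have bg : bijective g by apply: inj_card_bij => //; rewrite !card_sum !card_ord; lia.
have [f gK fK] := bg; exists f; split; first by exists g.
by move=> x y; rewrite extremalE -gU -gU -gB -gB -(inj_eq ginj) !fK eE.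
Qed.

End Graph.

(** * Minimization over s *)

Local Open Scope ring_scope.

(** A monic quadratic q(s) with axis 4k - 2n - 3/2, midway between two consecutive integers; the
    three cases depend on where these lie relative to 1 and k - 1. *)
Lemma twice_sigma2_extremalE (n k s : nat) : (0 < s < k)%N -> (k < n)%N ->
  (twice_sigma2_extremal n k s)%:R =
  s%:R ^+ 2 + (3 + 4 * n%:R - 8 * k%:R) * s%:R + 4 * k%:R ^+ 2 - 4 * k%:R :> rat.
Proof.
move=> sk kn; rewrite /twice_sigma2_extremal -!subn1 !natrD !natrM !natrB; try lia.
ring.
Qed.

(* floor((n+1)/2) = (n+1)./2 ; ceil((2n+1)/3) = (2n+3) %/ 3 *)
Theorem theorem4p5 (T : finType) (e : rel T) (k : nat) :
  symmetric e -> irreflexive e -> connected_graph e ->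
  (2 <= k)%N -> (k <= #|T| - 1)%N ->
  (is_chromatic_number e k \/ is_clique_number e k) ->
  let n := #|T| in
  let s2 : rat := (sigma2 e)%:R in
  [/\ ((k <= (n + 1)./2)%N ->
         let b : rat := 2 * n%:R + 2 * k%:R ^+ 2 - 6 * k%:R + 2 in
         b <= s2 /\ (s2 = b <-> isomorphic e (extremal n k 1))),
      ((n + 1)./2 < k < (2 * n + 3) %/ 3)%N ->
         let b : rat := (8 * k%:R - 3) * n%:R - 2 * n%:R ^+ 2
                        - 6 * k%:R ^+ 2 + 4 * k%:R - 1 in
         b <= s2 /\ (s2 = b <-> (isomorphic e (extremal n k (4 * k - 2 * n - 2))
                              \/ isomorphic e (extremal n k (4 * k - 2 * n - 1))))
    & ((2 * n + 3) %/ 3 <= k)%N ->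
         let b : rat := 2 * (k%:R - 1) * n%:R - 3 * k%:R ^+ 2 / 2
                        + 5 * k%:R / 2 - 1 in
         b <= s2 /\ (s2 = b <-> isomorphic e (extremal n k (k - 1)))].

Proof.
move=> es ei ec k2 kn h n s2; have kT : (k < n)%N by rewrite /n; lia.
have [s sk [lb eqs]] := sigma2_dichotomy es ei ec k2 kT h.
have E2 : s2 * 2 = (sigma2 e).*2%:R by rewrite -muln2 natrM.
have val t : isomorphic e (extremal n k t) -> (0 < t < k)%N ->
    s2 * 2 = t%:R ^+ 2 + (3 + 4 * n%:R - 8 * k%:R) * t%:R
             + 4 * k%:R ^+ 2 - 4 * k%:R.
  move=> /isomorphic_extremalP iso tk; rewrite -twice_sigma2_extremalE // E2.
  by rewrite (split_sigma2 es ei tk kT) //; apply: iso; lia.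
have iso : s2 * 2 = (twice_sigma2_extremal n k s)%:R -> isomorphic e (extremal n k s).
  rewrite E2 => /eqP; rewrite eqr_nat => /eqP /eqs str.
  by apply/isomorphic_extremalP => //; lia.
have {}lb : (twice_sigma2_extremal n k s)%:R <= s2 * 2 by rewrite E2 ler_nat.
rewrite twice_sigma2_extremalE // in lb iso.
have s_ge1 : 1 <= s%:R :> rat by rewrite ler1n; lia.
have s_lek : s%:R + 1 <= k%:R :> rat by rewrite natr1 ler_nat; lia.
split.
- move=> hk b.
  have hk' : 8 * k%:R <= 4 * n%:R + 4 :> rat.
    have : (8 * k <= 4 * n + 4)%N by lia.
    by rewrite -(ler_nat rat) natrD !natrM.
  (* This is the cofactor of s - 1 in q(s) - q(1); being positive, it leaves s = 1 as the only
     minimizer. *)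
  have pos : 0 < s%:R + 4 + 4 * n%:R - 8 * k%:R :> rat by lra.
  have gap : 0 <= (s%:R - 1) * (s%:R + 4 + 4 * n%:R - 8 * k%:R) :> rat.
    by apply: mulr_ge0; lra.
  split; first by rewrite /b; lra.
  split=> [sb|/val]; last by move=> /(_ k2) V; rewrite /b; lra.
  have /eqP : (s%:R - 1) * (s%:R + 4 + 4 * n%:R - 8 * k%:R) = 0 :> rat.
    by rewrite /b in sb; lra.
  rewrite mulf_eq0 (gt_eqF pos) orbF subr_eq0 pnatr_eq1 => /eqP s1; rewrite s1 in iso; apply: iso.
  by rewrite sb /b; ring.
- move=> hk b; set t := (4 * k - 2 * n - 2)%N.
  have -> : (4 * k - 2 * n - 1 = t.+1)%N by rewrite /t; lia.
  have [tk tk1] : (0 < t < k)%N /\ (0 < t.+1 < k)%N by rewrite /t; lia.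
  have tE : t%:R = 4 * k%:R - 2 * n%:R - 2 :> rat by rewrite /t !natrB ?natrM //; lia.
  (* The product is q(s) - q(t). It is nonnegative because no integer lies strictly between t and t
     + 1, and both of these are minimizers. *)
  have gap : 0 <= (s%:R - t%:R) * (s%:R - (t%:R + 1)) :> rat.
    have [st|ts] := leqP s t.
      have st' : s%:R <= t%:R :> rat by rewrite ler_nat.
      by apply: mulr_le0; lra.
    have ts' : t%:R + 1 <= s%:R :> rat by rewrite natr1 ler_nat.
    by apply: mulr_ge0; lra.
  rewrite tE in gap.
  split; first by rewrite /b; lra.
  split=> [sb|[/val/(_ tk)|/val/(_ tk1)]].
  + have /eqP : (s%:R - t%:R) * (s%:R - t.+1%:R) = 0 :> rat.
      by rewrite -(natr1 t) tE; rewrite /b in sb; lra.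
    have {}iso : isomorphic e (extremal n k s).
      by apply: iso; rewrite /b in sb; lra.
    by rewrite mulf_eq0 !subr_eq0 !eqr_nat => /orP[] /eqP E; [left|right]; rewrite -E.
  + by rewrite tE /b => V; lra.
  + by rewrite -(natr1 t) tE /b => V; lra.
- move=> hk b.
  have hk' : 2 * n%:R + 1 <= 3 * k%:R :> rat.
    have : (2 * n + 1 <= 3 * k)%N by lia.
    by rewrite -(ler_nat rat) natrD !natrM.
  (* This is the cofactor of k - 1 - s in q(s) - q(k - 1); from s <= k - 1 and 3k >= 2n + 1 it is at
     least 1. *)
  have pos : 0 < 7 * k%:R - 4 * n%:R - 2 - s%:R :> rat by lra.
  have gap : 0 <= (k%:R - 1 - s%:R) * (7 * k%:R - 4 * n%:R - 2 - s%:R) :> rat.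
    by apply: mulr_ge0; lra.
  split; first by rewrite /b; lra.
  split=> [sb|/val]; last first.
    have kk : (0 < k - 1 < k)%N by lia.
    by move=> /(_ kk) V; rewrite natrB in V; [rewrite /b; lra|lia].
  have /eqP : (k%:R - 1 - s%:R) * (7 * k%:R - 4 * n%:R - 2 - s%:R) = 0 :> rat.
    by rewrite /b in sb; lra.
  rewrite mulf_eq0 (gt_eqF pos) orbF -addrA -opprD subr_eq0 [1 + _]addrC natr1 eqr_nat => /eqP ks.
  have -> : (k - 1 = s)%N by lia.
  by apply: iso; rewrite /b in sb; lra.
Qed.
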